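(* Let $k\geq 2$. For any positive integers $\beta,\gamma,\alpha$ with $\max\{\gamma,\beta\}\leq\alpha\leq\gamma+\beta$ and $(\beta,\gamma,\alpha)\notin\{(1,\gamma,\gamma+1):\gamma\geq 2\}$, there exists a tree $T$ with $\dim(T)=\beta$, $\gamma_k(T)=\gamma$ and $\gamma^r_k(T)=\alpha$. Moreover, for $\gamma\geq 2$ there is no graph $G$ with $\dim(G)=1$, $\gamma_k(G)=\gamma$ and $\gamma^r_k(G)=\gamma+1$.
   Context: For a graph $G=(V,E)$ and $k\geq 1$, a set $D\subseteq V$ is distance $k$-dominating if every $v\in V\setminus D$ is at distance at most $k$ from some vertex of $D$; $\gamma_k(G)$ is the minimum size of such a set. An ordered set $W=\{w_1,\dots,w_r\}$ is a resolving set if for all distinct $u,v\in V\setminus W$ the distance vectors $(d_G(u,w_i))_i$ and $(d_G(v,w_i))_i$ differ; $\dim(G)$ is the minimum size of a resolving set. $\gamma^r_k(G)$ is the minimum cardinality of a set that is both resolving and distance $k$-dominating. *)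

(* Defs.v *)
(* MathComp world: finite simple graphs are relations on a finType. *)
From mathcomp Require Import all_boot.
Set Implicit Arguments.
Unset Strict Implicit.
Unset Printing Implicit Defensive.

Definition simple_graph (V : finType) (e : rel V) : Prop :=
  symmetric e /\ irreflexive e.

Definition connected_graph (V : finType) (e : rel V) : Prop :=
  [/\ simple_graph e, 0 < #|V| & forall u v : V, connect e u v].

(* For a simple graph, a cycle through at least 3 vertices is a genuine cycle;
   [:: u; v] with e u v satisfies ucycle but only runs back and forth along
   one edge. *)
Definition acyclic (V : finType) (e : rel V) : Prop :=
  forall c : seq V, ucycle e c -> size c <= 2.

Definition tree (V : finType) (e : rel V) : Prop :=
  connected_graph e /\ acyclic e.

(* Least length of a walk from u to v. A shortest walk visits no vertex twice,
   so lengths below #|V| suffice; the value is #|V| when no walk exists, hence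
   gdist is only meaningful on connected graphs. *)
Definition gdist (V : finType) (e : rel V) (u v : V) : nat :=
  find (fun n => [exists p : n.-tuple V, path e u p && (last u p == v)])
       (iota 0 #|V|).

Definition dist_dominating (V : finType) (e : rel V) (k : nat) (D : {set V}) :
    bool :=
  [forall v in ~: D, exists w in D, gdist e v w <= k].

(* The order in which enum lists W is immaterial: two distance vectors differ
   for one ordering of W iff they differ for every ordering. *)
Definition dist_vector (V : finType) (e : rel V) (W : {set V}) (u : V) :
    seq nat :=
  [seq gdist e u w | w <- enum W].

Definition resolving (V : finType) (e : rel V) (W : {set V}) : bool :=
  [forall u in ~: W, forall v in ~: W,
     (u != v) ==> (dist_vector e W u != dist_vector e W v)].

(* In the minima below setT always qualifies, so the arg min is a true
   minimizer. *)
Definition domination_number (V : finType) (e : rel V) (k : nat) : nat :=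
  #|[arg min_(D < [set: V] | dist_dominating e k D) #|D|]|.

Definition metric_dim (V : finType) (e : rel V) : nat :=
  #|[arg min_(W < [set: V] | resolving e W) #|W|]|.

Definition resolving_domination_number (V : finType) (e : rel V) (k : nat) :
    nat :=
  #|[arg min_(S < [set: V] | resolving e S && dist_dominating e k S) #|S|]|.

(* Main.v *)
(* In a graph of metric dimension 1 the distance to the resolving vertex is
   injective, so distances are those of a path and any two vertices form a
   resolving set; a dominating set with at least two vertices therefore resolves.

   The trees consist of a path whose positions 0, 2k+1, ..., q(2k+1) are called
   centers, with [p] legs of length 2k+1 and [s] legs of length [r] <= k hanging
   from position 0, and [b] = 0 or 2 legs of length [k] from the other end. The
   centers and the ends of the long legs are pairwise more than 2k apart and
   dominate everything, so gamma = 1 + q + p. A resolving set meets all but at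
   most one of the branches hanging from a vertex. When [r] = k, the end of a
   missed leg is dominated only by the center it hangs from, which makes the
   short legs useless for domination; when [r] = 1 and q = 0, the resolving
   leaves already dominate the center and all short legs. *)
Require Import Defs.
From mathcomp Require Import all_boot zify.
Set Implicit Arguments.
Unset Strict Implicit.
Unset Printing Implicit Defensive.

(** * Distances, domination and resolvability in an arbitrary graph *)

Section Distances.
Variables (V : finType) (e : rel V).

Lemma gdist_le_path x p : path e x p -> gdist e x (last x p) <= size p.
Proof.
(* A repetition-free path has fewer than [#|V|] edges, so its length is among those that [gdist]
   searches. *)
case/shortenP=> p' ep' up' sub_p.
have size_p' : size p' < #|V|.
  by have /card_uniqP E := up'; rewrite -[(size p').+1]/(size (x :: p')) -E max_card.
apply: leq_trans (uniq_leq_size (subseq_uniq (subseq_cons _ _) up') sub_p).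
rewrite leqNgt; apply/negP=> /(before_find 0).
rewrite nth_iota // add0n => /negbT/existsP[].
by exists (in_tuple p'); rewrite ep' eqxx.
Qed.

Lemma gdist_path x y : connect e x y ->
  exists p, [/\ path e x p, last x p = y & size p = gdist e x y].
Proof.
case/connectP=> p ep pl.
have dlt : gdist e x y < #|V|.
  case/shortenP: ep pl => p' ep' up' _ ->.
  apply: leq_ltn_trans (gdist_le_path ep') _.
  by have /card_uniqP E := up'; rewrite -[(size p').+1]/(size (x :: p')) -E max_card.
have: has (fun n => [exists p : n.-tuple V, path e x p && (last x p == y)])
  (iota 0 #|V|) by rewrite has_find size_iota.
move/(nth_find 0); rewrite nth_iota // add0n => /existsP[t /andP[et /eqP lt]].
by exists t; rewrite size_tuple.
Qed.

(** The Lipschitz condition along edges bounds every walk from below by [D]; repeatedly stepping to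
    a neighbour one closer to the target yields a walk of length exactly [D]. *)
Lemma gdistE (D : V -> V -> nat) :
    (forall x y, D x y = 0 <-> x = y) ->
    (forall x y z, e x y -> D x z <= (D y z).+1) ->
    (forall x z, x != z -> exists2 y, e x y & D x z = (D y z).+1) ->
  forall x y, connect e x y /\ gdist e x y = D x y.
Proof.
move=> D0 D1 DS x y.
have long p : path e x p -> D x (last x p) <= size p.
  elim: p x => [x _|z p IH x /= /andP[exz ep]]; first by rewrite leqn0; apply/eqP/D0.
  by apply: leq_trans (D1 _ _ _ exz) _; rewrite ltnS IH.
have [p [ep pl sp]] : exists p, [/\ path e x p, last x p = y & size p = D x y].
  move: {2}(D x y) (erefl (D x y)) => n; elim: n x {long} => [|n IH] x Dxy.
    by exists [::]; rewrite /= Dxy (proj1 (D0 _ _) Dxy).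
  have /DS[z exz Dz] : x != y by apply/eqP=> /D0; rewrite Dxy.
  have [|p [ep pl sp]] := IH z; first by lia.
  by exists (z :: p); rewrite /= exz ep sp Dz.
have cxy : connect e x y by apply/connectP; exists p.
split=> //; apply/eqP; rewrite eqn_leq -sp -{1}pl gdist_le_path //=.
by have [p' [ep' pl' <-]] := gdist_path cxy; rewrite sp -pl' long.
Qed.

Lemma dist_dominatingP k (D : {set V}) : (forall x, gdist e x x = 0) ->
  reflect (forall v, exists2 w, w \in D & gdist e v w <= k)
          (dist_dominating e k D).
Proof.
move=> d0; apply: (iffP forall_inP) => H v.
  have [vD|vD] := boolP (v \in D); first by exists v; rewrite ?d0.
  by apply/exists_inP/H; rewrite inE.
by move=> _; apply/exists_inP.
Qed.

Lemma resolvingP (W : {set V}) :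
  reflect (forall u v, u \notin W -> v \notin W ->
             {in W, forall w, gdist e u w = gdist e v w} -> u = v)
          (resolving e W).
Proof.
apply: (iffP forall_inP) => H u.
  move=> v uW vW E; have := H u; rewrite inE => /(_ uW) /forall_inP/(_ v).
  rewrite inE => /(_ vW) /implyP ineq.
  apply: contraTeq isT => /ineq /eqP[]; apply/eq_in_map => w.
  by rewrite mem_enum => /E.
rewrite inE => uW; apply/forall_inP=> v; rewrite inE => vW.
apply/implyP=> neq; apply: contraNneq neq => /eq_in_map E.
by apply/eqP/H => // w wW; apply: E; rewrite mem_enum.
Qed.

Lemma arg_min_card (P : pred {set V}) (n : nat) : P setT ->
    (exists2 A, P A & #|A| <= n) -> (forall A, P A -> n <= #|A|) ->
  #|[arg min_(A < [set: V] | P A) #|A|]| = n.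
Proof.
move=> PT [A PA An] lo; case: arg_minnP => // B PB minB.
by apply/eqP; rewrite eqn_leq lo // (leq_trans (minB _ PA)).
Qed.

Lemma resolving_setT : resolving e setT.
Proof. by apply/resolvingP=> u v; rewrite inE. Qed.

Lemma dist_dominating_setT k : dist_dominating e k setT.
Proof. by apply/forall_inP=> u; rewrite !inE. Qed.

(* Every label in [s] attained on [S] uses up its own element of [S]. *)
Lemma size_labels (f : V -> nat) (S : {set V}) (s : seq nat) : uniq s ->
  size s <= #|S| + count (fun t => [forall x in S, f x != t]) s.
Proof.
move=> us; rewrite -(count_predC (fun t => [forall x in S, f x != t]) s) addnC.
rewrite leq_add2r -size_filter cardE -(size_map f).
apply: uniq_leq_size; first exact: filter_uniq.
move=> t; rewrite mem_filter => /andP[/= /forall_inPn[x xS /negPn/eqP <-] _].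
by rewrite map_f // mem_enum.
Qed.

End Distances.

(** Applied to the labels that a set misses, it combines with [size_labels] into lower bounds on the
    size of that set. *)
Lemma count_le1 (P : pred nat) (s : seq nat) : uniq s ->
  {in s &, forall i j, P i -> P j -> i = j} -> count P s <= 1.
Proof.
move=> us H; rewrite -size_filter.
case E: (filter P s) => [|i [|j t]] //.
have /= : uniq (filter P s) by rewrite filter_uniq.
have : i \in filter P s by rewrite E inE eqxx.
have : j \in filter P s by rewrite E !inE eqxx orbT.
rewrite !mem_filter E => /andP[Pj js] /andP[Pi iss] /=.
by rewrite (H i j) // inE eqxx.
Qed.

(** * Graphs of metric dimension one *)

Lemma dim1_resolving_domination (k : nat) (V : finType) (e : rel V) : connected_graph e ->
  metric_dim e = 1 -> 2 <= domination_number e k ->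
  resolving_domination_number e k = domination_number e k.
Proof.
case=> -[sym irr] _ conn.
rewrite /metric_dim; case: arg_minnP => [|W resW _ /eqP/cards1P[w Ww]].
  exact: resolving_setT.
have d0 x y : gdist e x y = 0 -> x = y.
  by have [[|? ?] [_ <- // <-]] := gdist_path (conn x y).
have dxx x : gdist e x x = 0.
  by apply/eqP; rewrite -leqn0; apply: (@gdist_le_path _ _ x [::]).
have d1 x y z : e x y -> gdist e x z <= (gdist e y z).+1.
  move=> exy; have [p [ep pl <-]] := gdist_path (conn y z).
  by rewrite -pl; apply: (@gdist_le_path _ _ x (y :: p)); rewrite /= exy.
pose f x := gdist e x w.
have f_inj : injective f.
  move=> x y Exy.
  (* Resolvability only compares vertices other than [w]; [w] itself is the only vertex at distance
     0 from [w]. *)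
  have [xw|xw] := eqVneq x w.
    by apply/esym/d0; rewrite xw -/(f y) -Exy /f xw dxx.
  have [yw|yw] := eqVneq y w.
    by apply/d0; rewrite yw -/(f x) Exy /f yw dxx.
  have /resolvingP := resW; rewrite Ww; apply; rewrite ?inE //.
  by move=> u /set1P ->.
have down x n : f x = n.+1 -> exists2 y, e x y & f y = n.
  move=> fx; have [[|y p] /= [ep pl sp]] := gdist_path (conn x w).
    by move: fx; rewrite /f -sp.
  case/andP: ep => exy ep; exists y => //.
  have := gdist_le_path ep; rewrite pl -/(f y); have := d1 _ _ w exy.
  rewrite -/(f x) -/(f y); move: sp; rewrite -/(f x) => sp; lia.
have level x n m : f x = n + m -> exists y, f y = n.
  elim: m x => [|m IH] x fx; first by exists x; rewrite fx addn0.
  by have [|y _ /IH] := down x (n + m); first by rewrite fx addnS.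
have dE x y : gdist e x y = (f x - f y) + (f y - f x).
  apply: (proj2 (gdistE (D := fun x y => (f x - f y) + (f y - f x)) _ _ _ x y)).
  - by move=> {}x {}y; split=> [E|->]; [apply: f_inj; lia | lia].
  - move=> {}x {}y z exy; have := d1 _ _ w exy; have := d1 y x w.
    by rewrite sym exy => /(_ isT); rewrite -!/(f _); lia.
  move=> {y}x z xz; have fxz : f x != f z by rewrite (inj_eq f_inj).
  have [lt|ge] := ltnP (f z) (f x).
    have [|y exy fy] := down x (f x).-1; first by lia.
    by exists y => //; lia.
  (* Going up: some [u] lies one level above [x], its neighbour one level down has the level of [x],
     and by injectivity that neighbour is [x]. *)
  have [|u fu] := @level z (f x).+1 (f z - (f x).+1); first by lia.
  have [y euy fy] := down _ _ fu; exists u; last by lia.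
  by rewrite sym -(f_inj _ _ fy).
rewrite /domination_number; case: arg_minnP => [|D domD minD gt1].
  exact: dist_dominating_setT.
apply: arg_min_card.
- by rewrite resolving_setT dist_dominating_setT.
- exists D => //; rewrite domD andbT; apply/resolvingP=> u v uD vD E.
  (* If [f u] and [f v] differed, [f a] and [f b] would both be their midpoint. *)
  have /card_gt1P[a [b [aD bD ab]]] := gt1.
  have fab : f a != f b by rewrite (inj_eq f_inj).
  by apply: f_inj; have := E a aD; have := E b bD; rewrite !dE; lia.
by move=> A /andP[_ /minD].
Qed.

(** * Paths with legs: coordinates, metric and tree structure *)

Section LeggedPath.
Variables (L m : nat) (base len : nat -> nat).
Hypothesis base_le : forall i, base i <= L.

(* Vertices: the positions 0..L of a path, and the legs 1..m; leg [i] hangs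
   from position [base i] and has [len i] vertices. *)
Definition lvertex : finType := ('I_L.+1 + {i : 'I_m & 'I_(len i.+1)})%type.

(* Leg number, 0 standing for the path itself. *)
Definition leg (x : lvertex) : nat :=
  if x is inr t then (tag t).+1 else 0.
Definition pos (x : lvertex) : nat :=
  match x with inl b => b | inr t => base (tag t).+1 end.
Definition height (x : lvertex) : nat :=
  if x is inr t then (tagged t).+1 else 0.

Lemma coordP x :
  leg x = 0 /\ height x = 0 /\ pos x <= L \/
  0 < leg x <= m /\ 0 < height x <= len (leg x) /\ pos x = base (leg x).
Proof.
case: x => [b|[i j]] /=; [left | right]; first by have := ltn_ord b; lia.
by have := ltn_ord i; have := ltn_ord j; lia.
Qed.

Lemma pos_le x : pos x <= L.
Proof. by case: (coordP x) => [|[_ [_ ->]]]; [lia | exact: base_le]. Qed.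

Lemma coord_inj x y :
  leg x = leg y -> pos x = pos y -> height x = height y -> x = y.
Proof.
case: x y => [b|[i j]] [b'|[i' j']] //=; first by move=> _ /val_inj ->.
by case=> /val_inj E; subst i' => _ [/val_inj ->].
Qed.

Definition lvalid (l b h : nat) : Prop :=
  l = 0 /\ h = 0 /\ b <= L \/ 0 < l <= m /\ 0 < h <= len l /\ b = base l.

(** Natural-number coordinates avoid dependent indices; the default [inl ord0] is returned only for
    triples that are not [lvalid]. *)
Definition vtx (l b h : nat) : lvertex :=
  odflt (inl ord0)
    [pick x | (leg x == l) && (pos x == b) && (height x == h)].

Lemma vtxP l b h : lvalid l b h ->
  [/\ leg (vtx l b h) = l, pos (vtx l b h) = b & height (vtx l b h) = h].
Proof.
move=> v.
have [x [x1 x2 x3]] : exists x : lvertex, [/\ leg x = l, pos x = b & height x = h].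
  case: v => [[-> [-> bL]]|[lm [hl ->]]].
    by exists (inl (Ordinal (bL : b < L.+1))).
  case: l lm hl => // l lm; case: h => // h hl.
  by exists (inr (Tagged (fun i : 'I_m => 'I_(len i.+1)) (Ordinal hl : 'I_(len (Ordinal lm).+1)))).
rewrite /vtx; case: pickP => [y /andP[/andP[/eqP-> /eqP->] /eqP->] //|/(_ x)].
by rewrite x1 x2 x3 !eqxx.
Qed.

Definition ldist (x y : lvertex) : nat :=
  (pos x - pos y) + (pos y - pos x) +
  if leg x == leg y then (height x - height y) + (height y - height x)
  else height x + height y.

(** The edges are read off from the intended metric; [gdistE] then identifies the graph distance
    with [ldist]. *)
Definition ladj : rel lvertex := fun x y => ldist x y == 1.

Lemma ldist_sym x y : ldist x y = ldist y x.
Proof. by rewrite /ldist eq_sym; case: eqP => _; lia. Qed.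

Lemma ladj_gdist x y : connect ladj x y /\ gdist ladj x y = ldist x y.
Proof.
apply: gdistE => {x y} [x y|x y z|x z xz].
- split=> [|->]; last by rewrite /ldist eqxx; lia.
  rewrite /ldist => D0.
  have E : leg x = leg y.
    by move: D0; case: eqP => // ne; have := coordP x; have := coordP y; lia.
  by apply: coord_inj => //; move: D0; rewrite E eqxx; lia.
- rewrite /ladj /ldist => /eqP.
  by case: eqP => xy; case: eqP => xz; case: eqP => yz; lia.
have cx := coordP x; have cz := coordP z.
have mk l b h : lvalid l b h ->
    (forall y, leg y = l -> pos y = b -> height y = h -> ldist x y = 1) ->
    (forall y, leg y = l -> pos y = b -> height y = h ->
               ldist x z = (ldist y z).+1) ->
  exists2 y, ladj x y & ldist x z = (ldist y z).+1.
  move=> /vtxP[y1 y2 y3] H1 H2; exists (vtx l b h); last exact: H2.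
  by rewrite /ladj H1.
case: cx => [[lx [hx bx]]|[lx [hx bx]]].
  have [lt|ge] := ltnP (pos x) (pos z).
    apply: (mk 0 (pos x).+1 0); first by left; have := pos_le z; lia.
      by move=> y; rewrite /ldist => -> -> ->; rewrite lx hx eqxx; lia.
    by move=> y; rewrite /ldist => -> -> ->; rewrite lx hx; case: eqP => _; lia.
  have [gt|le] := ltnP (pos z) (pos x).
    apply: (mk 0 (pos x).-1 0); first by left; lia.
      by move=> y; rewrite /ldist => -> -> ->; rewrite lx hx eqxx; lia.
    by move=> y; rewrite /ldist => -> -> ->; rewrite lx hx; case: eqP => _; lia.
  have eb : pos x = pos z by lia.
  have lz : 0 < leg z.
    rewrite lt0n; apply: contraNneq xz => lz0; apply/eqP; apply: coord_inj; lia.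
  apply: (mk (leg z) (pos z) 1); first by right; lia.
    move=> y; rewrite /ldist => -> -> ->; rewrite lx hx.
    by case: eqP => _; lia.
  move=> y; rewrite /ldist => -> -> ->; rewrite lx hx eqxx.
  by case: eqP => _; lia.
(* A vertex on a leg moves up only towards a higher vertex of the same leg; otherwise it moves down,
   and from height 1 it drops onto the path, where the leg number becomes 0. *)
have [/andP[/eqP lxz lt]|up] := boolP ((leg x == leg z) && (height x < height z)).
  apply: (mk (leg x) (pos x) (height x).+1); first by right; move: cz; rewrite -lxz; lia.
    by move=> y; rewrite /ldist => -> -> ->; rewrite eqxx; lia.
  by move=> y; rewrite /ldist => -> -> ->; rewrite lxz eqxx; lia.
have same : leg x = leg z -> height z < height x.
  move=> E; rewrite ltn_neqAle; apply/andP; split; last by lia.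
  apply: contraNneq xz => Eh; apply/eqP; apply: coord_inj => //.
  case: cz => [|[_ [_ ->]]]; first by lia.
  by rewrite bx E.
have [h1|h1] := eqVneq (height x) 1.
  apply: (mk 0 (pos x) 0); first by left; have := pos_le x; lia.
    move=> y; rewrite /ldist => -> -> ->; rewrite h1.
    by case: eqP => _; lia.
  move=> y; rewrite /ldist => -> -> ->; rewrite h1.
  by case: eqP => E; case: eqP => E'; lia.
apply: (mk (leg x) (pos x) (height x).-1); first by right; lia.
  by move=> y; rewrite /ldist => -> -> ->; rewrite eqxx; lia.
by move=> y; rewrite /ldist => -> -> ->; case: eqP => E; lia.
Qed.

(* Orienting the tree towards position 0, a vertex has only one neighbour that
   is no farther from the root; the farthest vertex of a cycle would have two. *)
Lemma ladj_tree : tree ladj.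
Proof.
split; first split.
- split=> [x y|x]; first by rewrite /ladj ldist_sym.
  by rewrite /ladj /ldist eqxx; lia.
- by apply/card_gt0P; exists (inl ord0).
- by move=> x y; have [] := ladj_gdist x y.
pose depth x := pos x + height x.
have parent x y z : ladj x y -> ladj x z -> depth y <= depth x ->
    depth z <= depth x -> y = z.
  rewrite /ladj /ldist /depth => /eqP xy /eqP xz dy dz.
  have := coordP x; have := coordP y; have := coordP z => cz cy cx.
  move: xy xz; case: eqP => exy; case: eqP => exz xy xz; apply: coord_inj;
  move: cx cy cz; rewrite -?exy -?exz; lia.
move=> c /andP[cyc uc]; rewrite leqNgt; apply/negP=> size_c.
have [x0 x0c] : exists x0, x0 \in c by case: c size_c {cyc uc} => // x ?; exists x; rewrite mem_head.
have [x xc xmax] := arg_maxnP depth (x0c : mem c x0).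
have [i c' rotc] := rot_to xc.
have := cyc; rewrite -(rot_cycle i) rotc /=.
have := uc; rewrite -(rot_uniq i) rotc.
have mem_c y : y \in c' -> y \in c.
  by rewrite -(mem_rot i c) rotc inE => ->; rewrite orbT.
have : 1 < size c' by move: size_c; rewrite -(size_rot i c) rotc.
case: c' {rotc} mem_c => // y c' mem_c; case/lastP: c' mem_c => // c' z mem_c _.
rewrite rcons_path /= last_rcons => u /andP[/andP[xy _] zx].
have yz : y = z.
  apply: (parent x) => //; first by rewrite /ladj ldist_sym.
    by apply: xmax; apply: mem_c; rewrite mem_head.
  by apply: xmax; apply: mem_c; rewrite inE mem_rcons mem_head orbT.
by move: u; rewrite yz mem_rcons mem_head /= andbF.
Qed.

Lemma ldist_vtx x l b h : lvalid l b h ->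
  ldist x (vtx l b h) = (pos x - b) + (b - pos x) +
    if leg x == l then (height x - h) + (h - height x) else height x + h.
Proof. by case/vtxP=> e1 e2 e3; rewrite /ldist e1 e2 e3. Qed.

Lemma ladj_dominatingP k (D : {set lvertex}) :
  reflect (forall v, exists2 w, w \in D & ldist v w <= k)
          (dist_dominating ladj k D).
Proof.
have gE x y : gdist ladj x y = ldist x y := proj2 (ladj_gdist x y).
apply: (iffP (dist_dominatingP _ _ _)).
- by move=> x; rewrite gE /ldist eqxx; lia.
- by move=> H v; have [w wD] := H v; exists w => //; rewrite -gE.
by move=> H v; have [w wD] := H v; exists w => //; rewrite gE.
Qed.

Lemma ladj_resolvingP (W : {set lvertex}) :
  reflect (forall u v, u \notin W -> v \notin W ->
             {in W, forall w, ldist u w = ldist v w} -> u = v)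
          (resolving ladj W).
Proof.
have gE x y : gdist ladj x y = ldist x y := proj2 (ladj_gdist x y).
apply: (iffP (resolvingP _ _)) => H u v uW vW E;
by apply: H => // w /E; rewrite ?gE.
Qed.

(** The lowest vertices of two legs with a common base are equidistant from every vertex outside
    both legs. *)
Lemma twin_legs (W : {set lvertex}) i j : resolving ladj W ->
    0 < i <= m -> 0 < j <= m -> 0 < len i -> 0 < len j -> base i = base j ->
    {in W, forall x, leg x <> i /\ leg x <> j} -> i = j.
Proof.
move=> /ladj_resolvingP resW im jm li lj bij noW; apply/eqP.
have vi : lvalid i (base i) 1 by right; lia.
have vj : lvalid j (base j) 1 by right; lia.
have [i1 _ _] := vtxP vi; have [j1 _ _] := vtxP vj.
apply/negPn/negP => ij.
have : vtx i (base i) 1 = vtx j (base j) 1.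
  apply: resW; try by apply/negP=> /noW; lia.
  move=> w /noW[wi wj]; rewrite ldist_sym [RHS]ldist_sym !ldist_vtx // bij.
  by case: eqP => // _; case: eqP.
by move/(congr1 leg); rewrite i1 j1; apply/eqP.
Qed.

(** Vertices of leg [i] are closer than [len i] to its end and all others are at least that far, so
    [v] is on the leg too, at the same height. *)
Lemma leaf_resolves i u v : 0 < i <= m -> 0 < len i ->
    ldist u (vtx i (base i) (len i)) = ldist v (vtx i (base i) (len i)) ->
  leg u = i -> u = v.
Proof.
move=> im li; have vi : lvalid i (base i) (len i) by right; lia.
rewrite !ldist_vtx // => E ui; move: E; rewrite ui eqxx.
have := coordP u; have := coordP v; rewrite ui; case: eqP => [vE|vE] cv cu E.
  by apply: coord_inj; move: cv; rewrite ?vE; lia.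
by lia.
Qed.

End LeggedPath.

(** * The tree family and its three parameters *)

Section Family.
Variables (k q p s r b K n m L : nat).
Hypotheses (s_gt0 : 0 < s) (r_gt0 : 0 < r) (r_le : r <= k).
(** This excludes degenerate trees whose dimension differs from [n.-1 + (0 < q)]: for instance
    [b = q = 0] with [n = 1] gives a path, of dimension 1, and [b = 2] with [n = 1] and [0 < q]
    gives three branches at position [L], hence dimension 2. *)
Hypothesis shape : b = 0 /\ (0 < q \/ 1 < n) \/ [/\ b = 2, 0 < q & 1 < n].
Hypotheses (KE : K = k.*2.+1) (nE : n = p + s) (mE : m = n + b) (LE : L = q * K).

(* Legs 1..p have length K and legs p+1..n length r, all hanging from position
   0; legs n+1..m have length k and hang from position L. *)
Definition legbase i := if i <= n then 0 else L.
Definition leglen i := if i <= p then K else if i <= n then r else k.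

Lemma legbaseE i : legbase i = if i <= n then 0 else L. Proof. by []. Qed.

Lemma leglenE i : leglen i = if i <= p then K else if i <= n then r else k.
Proof. by []. Qed.

Local Notation V := (lvertex L m leglen).
Local Notation adj := (@ladj L m legbase leglen).
Local Notation vert := (vtx L m legbase leglen).
Local Notation pos := (@pos L m legbase leglen).
Local Notation ldist := (@ldist L m legbase leglen).
Local Notation valid := (lvalid L m legbase leglen).

Lemma legbase_le i : legbase i <= L.
Proof. by rewrite legbaseE; case: ifP. Qed.

Lemma q_L : q = 0 /\ L = 0 \/ 0 < q /\ K <= L.
Proof. by rewrite LE; case: (posnP q) => [->|q0]; [left | right; rewrite leq_pmull]. Qed.

Lemma K_gt0 : 0 < K. Proof. by rewrite KE. Qed.

Lemma leg_cases (x : V) :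
  [\/ leg x = 0 /\ height x = 0 /\ pos x <= L,
      0 < leg x <= p /\ 0 < height x <= K /\ pos x = 0,
      p < leg x <= n /\ 0 < height x <= r /\ pos x = 0 |
      n < leg x <= m /\ 0 < height x <= k /\ pos x = L].
Proof.
case: (coordP legbase x) => [|[lx [hx bx]]]; first by constructor 1.
move: hx; rewrite bx legbaseE leglenE.
case: (leqP (leg x) p) => lp; first by rewrite ifT; [constructor 2 |]; lia.
by case: (leqP (leg x) n) => ln ?; [constructor 3 | constructor 4]; lia.
Qed.

Definition center t : V := vert 0 (t * K) 0.
Definition leaf i : V := vert i (legbase i) (leglen i).

Lemma center_valid t : t <= q -> valid 0 (t * K) 0.
Proof. by move=> tq; left; rewrite LE leq_mul2r tq orbT. Qed.

Lemma leglen_gt0 i : 0 < leglen i.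
Proof. by rewrite leglenE; case: ifP => _; [|case: ifP => _]; lia. Qed.

Lemma leaf_valid i : 0 < i <= m ->
  valid i (legbase i) (leglen i).
Proof. by move=> im; right; rewrite im leglen_gt0 leqnn. Qed.

Lemma dist_center (x : V) t : t <= q ->
  ldist x (center t) = (pos x - t * K) + (t * K - pos x) + height x.
Proof.
move=> tq; rewrite ldist_vtx; last exact: center_valid.
by case: eqP => _; lia.
Qed.

Lemma dist_leaf (x : V) i : 0 < i <= m ->
  ldist x (leaf i) = (pos x - legbase i) + (legbase i - pos x) +
    if leg x == i then leglen i - height x else height x + leglen i.
Proof.
move=> im; rewrite ldist_vtx; last exact: leaf_valid.
by case: eqP => // xi; have := coordP legbase x; rewrite xi; lia.
Qed.

Lemma block t a : t * K <= a < t.+1 * K -> a %/ K = t.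
Proof.
case/andP=> lo hi; apply/eqP.
by rewrite eqn_leq -ltnS ltn_divLR ?K_gt0 // hi leq_divRL ?K_gt0.
Qed.

(** The positions within [k] of [t * K] form an interval of length [K = 2k+1]; shifting by [k] turns
    these intervals into the blocks of division by [K]. *)
Lemma block_near (x : V) t :
  (pos x - t * K) + (t * K - pos x) + height x <= k -> (pos x + k) %/ K = t.
Proof. by move=> ?; apply: block; rewrite mulSn KE; lia. Qed.

Lemma near_block (x : V) :
  exists2 t, t <= q & (pos x - t * K) + (t * K - pos x) <= k.
Proof.
exists ((pos x + k) %/ K).
  have xL := pos_le legbase_le x.
  by rewrite -ltnS ltn_divLR ?K_gt0 // mulSn KE; lia.
have := divn_eq (pos x + k) K; have : (pos x + k) %% K < K by rewrite ltn_pmod ?K_gt0.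
by lia.
Qed.

(** On a long leg, center 0 covers heights up to [k] and the leaf covers heights [k+1] to [2k+1];
    the other legs are no longer than [k]. *)
Lemma centers_dominate (S : {set V}) :
    (forall t, t <= q -> center t \in S) ->
    (forall i, 0 < i <= p -> leaf i \in S) ->
  dist_dominating adj k S.
Proof.
move=> cS lS; apply: introT (ladj_dominatingP legbase_le _ _) _ => x.
have c0 := cS 0 isT; have d0 := @dist_center x 0 isT.
have cq := cS q (leqnn q); have dq := @dist_center x q (leqnn q).
case: (leg_cases x) => [[l [h _]]|[l [h b0]]|[l [h b0]]|[l [h b0]]].
- have [t tq tk] := near_block x; exists (center t); first exact: cS.
  by rewrite dist_center //; lia.
- case: (leqP (height x) k) => hk; first by exists (center 0) => //; lia.
  exists (leaf (leg x)); first exact: lS.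
  rewrite dist_leaf ?eqxx; last by lia.
  have -> : legbase (leg x) = 0 by rewrite legbaseE; case: ifP => //; lia.
  have -> : leglen (leg x) = K by rewrite leglenE; case: ifP => //; lia.
  by lia.
- by exists (center 0) => //; lia.
- by exists (center q) => //; lia.
Qed.

Lemma card_set_seq (t : seq V) : #|[set x in t]| <= size t.
Proof. by rewrite cardsE card_size. Qed.

Lemma family_domination : domination_number adj k = 1 + q + p.
Proof.
apply: arg_min_card; first exact: dist_dominating_setT.
  exists [set x in [seq center t | t <- iota 0 q.+1] ++
                   [seq leaf i | i <- iota 1 p]].
    apply: centers_dominate => t tq; rewrite inE mem_cat map_f ?orbT //.
    - by rewrite mem_iota; lia.
    - by rewrite mem_iota; lia.
  apply: leq_trans (card_set_seq _) _.
  by rewrite size_cat !size_map !size_iota; lia.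
move=> S /(ladj_dominatingP legbase_le) domS.
(* The label names the only center or long leaf that [x] can dominate, so a dominating set attains
   all [1 + q + p] labels. *)
pose f (x : V) := if (0 < leg x <= p) && (k < height x) then q + leg x
                  else (pos x + k) %/ K.
have := size_labels f S (iota_uniq 0 (1 + q + p)); rewrite size_iota.
suff /eqP -> : count (fun t => [forall x in S, f x != t]) (iota 0 (1 + q + p)) == 0.
  by rewrite addn0.
rewrite -leqn0 leqNgt -has_count; apply/hasPn=> t; rewrite mem_iota => tr.
apply/forall_inPn; case: (leqP t q) => tq.
  have [x xS b0] := domS (center t); exists x => //; rewrite negbK.
  move: b0; rewrite ldist_sym dist_center // => b0.
  rewrite /f ifF; last by lia.
  by rewrite (block_near b0).
have tp : 0 < t - q <= p by lia.
have [x xS b0] := domS (leaf (t - q)); exists x => //; rewrite negbK.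
move: b0; rewrite ldist_sym dist_leaf; last by lia.
have -> : leglen (t - q) = K by rewrite leglenE; case: ifP => //; lia.
case: eqP => [lx|_]; last by lia.
by rewrite /f lx tp KE => ?; rewrite ifT; lia.
Qed.

Lemma labels_missed (S : {set V}) (f : V -> nat) t :
  [forall x in S, f x != t] -> {in S, forall x, f x <> t}.
Proof. by move/forall_inP=> H x /H /eqP. Qed.

Lemma twins (S : {set V}) i j : resolving adj S ->
    0 < i <= m -> 0 < j <= m -> (i <= n) = (j <= n) ->
    {in S, forall x, leg x <> i /\ leg x <> j} -> i = j.
Proof.
move=> resS im jm ij; apply: twin_legs resS im jm _ _ _ => //.
- exact: legbase_le.
- exact: leglen_gt0.
- exact: leglen_gt0.
by rewrite legbaseE ij.
Qed.

Lemma resolving_card (S : {set V}) : resolving adj S -> n.-1 + (0 < q) <= #|S|.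
Proof.
move=> resS; have := q_L => qK.
have b02 : b = 0 \/ b = 2 by case: shape => [[]|[]]; [left | right].
(* Labels are branches. If [b = 0], the path beyond position 0 is one more branch there, numbered
   [n.+1]; if [b = 2], the two far legs form a second group of branches. *)
pose f (x : V) := if 0 < leg x then leg x
                  else if (b == 0) && (0 < pos x) then n.+1 else 0.
have miss i : 0 < i -> [forall x in S, f x != i] -> {in S, forall x, leg x <> i}.
  by move=> i0 /labels_missed H x /H; rewrite /f; case: ifP; lia.
case: b02 => bE.
  have := size_labels f S (iota_uniq 1 (n + (0 < q))); rewrite size_iota.
  suff : count (fun t => [forall x in S, f x != t]) (iota 1 (n + (0 < q))) <= 1.
    by lia.
  apply: count_le1 (iota_uniq _ _) _.
  have main i j : 0 < i <= n -> 0 < j <= n + (0 < q) ->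
      [forall x in S, f x != i] -> [forall x in S, f x != j] -> i = j.
    move=> ir jr mi mj; have nomi := miss i _ mi; have nomj := miss j _ mj.
    have [jn|jn] := leqP j n.
      apply: twins resS _ _ _ _; try lia.
      by move=> x xS; split; [apply: nomi | apply: nomj]; lia.
    have q0 : 0 < q by case: (q) jr jn => //; lia.
    (* Here [j] is the path branch: position 1 and the lowest vertex of leg [i] play the role of the
       twins. *)
    have vi : valid i 0 1.
      right; have := leglen_gt0 i; rewrite legbaseE ifT; last by lia.
      by lia.
    have v1 : valid 0 1 0 by left; lia.
    have [i1 i2 i3] := vtxP vi; have [o1 o2 o3] := vtxP v1.
    have /(ladj_resolvingP legbase_le) := resS => /(_ (vert i 0 1) (vert 0 1 0)).
    have f1 : f (vert i 0 1) = i by rewrite /f i1; case: ifP => //; lia.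
    have f2 : f (vert 0 1 0) = j by rewrite /f o1 o2 bE /=; lia.
    have out w t : [forall x in S, f x != t] -> f w = t -> w \notin S.
      by move=> mt ft; apply/negP=> /(labels_missed mt).
    move/(_ (out _ _ mi f1) (out _ _ mj f2)) => same.
    suff : vert i 0 1 = vert 0 1 0 by move/(congr1 (@leg L m leglen)); rewrite i1 o1; lia.
    apply: same => w wS; rewrite ldist_sym [RHS]ldist_sym !ldist_vtx //.
    have wi : leg w <> i by apply: nomi => //; lia.
    have := labels_missed mj wS; rewrite /f bE /=.
    by case: (leg_cases w) => cw; do ![case: ifP => ?]; lia.
  move=> i j; rewrite !mem_iota => ir jr mi mj.
  have [iN|iN] := leqP i n; first by apply: main => //; lia.
  have [jN|jN] := leqP j n; first by apply/esym/main => //; lia.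
  by lia.
have us : uniq (iota 1 n ++ iota n.+1 2).
  by rewrite -(iotaD 1) iota_uniq.
(* One missed label is allowed per end, which leaves [n.-1 + 1]. *)
have := size_labels f S us; rewrite size_cat !size_iota count_cat.
suff /andP[] : (count (fun t => [forall x in S, f x != t]) (iota 1 n) <= 1) &&
       (count (fun t => [forall x in S, f x != t]) (iota n.+1 2) <= 1).
  by lia.
apply/andP; split; apply: count_le1 (iota_uniq _ _) _ => i j;
  rewrite !mem_iota => ir jr /miss mi /miss mj;
  apply: twins resS _ _ _ _; try lia;
  by move=> x xS; split; [apply: mi | apply: mj]; lia.
Qed.

Lemma leaf_sep (S : {set V}) i (u v : V) : 0 < i <= m -> leaf i \in S ->
  {in S, forall w, ldist u w = ldist v w} -> u <> v -> leg u <> i /\ leg v <> i.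
Proof.
move=> im iS E uv; have Ei := E _ iS.
split=> li; apply: uv; first exact: leaf_resolves im (leglen_gt0 i) Ei li.
by apply/esym; apply: leaf_resolves im (leglen_gt0 i) (esym Ei) li.
Qed.

Lemma family_dim : metric_dim adj = n.-1 + (0 < q).
Proof.
apply: arg_min_card; [exact: resolving_setT | | exact: resolving_card].
(* The leaves at position 0 leave one leg there unmarked; [far] tells it from the path, and if
   [b = 2] it also separates the two far legs. *)
set far := if b == 0 then center q else leaf n.+1.
exists [set x in [seq leaf i | i <- iota 1 n.-1] ++ nseq (0 < q) far].
  apply/(ladj_resolvingP legbase_le) => u v _ _ E.
  have leafE i : 0 < i < n -> ldist u (leaf i) = ldist v (leaf i).
    by move=> ir; apply: E; rewrite inE mem_cat map_f // mem_iota; lia.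
  have farE : 0 < q -> ldist u far = ldist v far.
    by move=> q0; apply: E; rewrite inE mem_cat q0 mem_head orbT.
  case: (eqVneq u v) => // /eqP uv; exfalso.
  have sep i : 0 < i < n -> leg u <> i /\ leg v <> i.
    move=> ir; apply: leaf_sep E uv; first by lia.
    by rewrite inE mem_cat map_f // mem_iota; lia.
  (* Off leg 1, the distance to its leaf is a constant plus the distance to position 0. *)
  have first : 1 < n -> pos u + height u = pos v + height v.
    move=> n1; have [u1 v1] := sep 1 n1.
    have b1 : legbase 1 = 0 by rewrite legbaseE ifT; lia.
    by have := leafE 1 n1; rewrite !dist_leaf ?b1; [do ![case: eqP => ?]; lia | lia..].
  have inj : pos u = pos v -> height u = height v -> leg u <> leg v.
    by move=> pE hE lE; apply/uv/coord_inj; eauto.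
  have su := sep (leg u); have sv := sep (leg v).
  have qL := q_L.
  move: farE; rewrite /far; case: eqP => b0.
    rewrite !dist_center // -LE => farE.
    have qn : 0 < q \/ 1 < n by case: shape => [[]|[]]; [|left].
    by case: (leg_cases u) => cu; case: (leg_cases v) => cv; lia.
  have bE : b = 2 by case: shape => [[]|[]].
  have q0 : 0 < q by case: shape => [[]|[]].
  have n1 : 1 < n by case: shape => [[]|[]].
  have nm : 0 < n.+1 <= m by lia.
  have [un vn] : leg u <> n.+1 /\ leg v <> n.+1.
    apply: leaf_sep E uv => //.
    by rewrite inE mem_cat q0 /far; case: eqP => // _; rewrite mem_head orbT.
  have bn : legbase n.+1 = L by rewrite legbaseE ifF; lia.
  rewrite !dist_leaf // bn => /(_ q0); do ![case: eqP => // _] => farE.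
  by case: (leg_cases u) => cu; case: (leg_cases v) => cv; lia.
apply: leq_trans (card_set_seq _) _.
by rewrite size_cat size_map size_iota size_nseq.
Qed.

Lemma centers_resolve (S : {set V}) :
    center 0 \in S -> center q \in S -> (forall i, 0 < i < n -> leaf i \in S) ->
    (b = 2 -> leaf n.+1 \in S) ->
  resolving adj S.
Proof.
move=> c0 cq lS far; apply/(ladj_resolvingP legbase_le) => u v _ _ E.
case: (eqVneq u v) => // /eqP uv; exfalso.
have sep i : 0 < i < n -> leg u <> i /\ leg v <> i.
  by move=> ir; apply: leaf_sep E uv; [lia | apply: lS].
have sepn : b = 2 -> leg u <> n.+1 /\ leg v <> n.+1.
  by move=> b2; apply: leaf_sep E uv; [lia | apply: far].
have inj : pos u = pos v -> height u = height v -> leg u <> leg v.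
  by move=> pE hE lE; apply/uv/coord_inj; eauto.
(* The two end centers determine [pos + height] and [L - pos + height], hence both coordinates; only
   the leg remains to be recovered. *)
have [pE hE] : pos u = pos v /\ height u = height v.
  have := E _ c0; have := E _ cq; rewrite !dist_center // -LE.
  by move: (pos_le legbase_le u) (pos_le legbase_le v); clear; lia.
have su := sep (leg u); have sv := sep (leg v); have luv := inj pE hE.
have b02 : b = 0 \/ b = 2 /\ K <= L.
  by case: shape => [[b0 _]|[b2 q0 _]]; [left | right; have := q_L; lia].
by case: (leg_cases u) => cu; case: (leg_cases v) => cv;
  clear -su sv sepn luv b02 pE hE KE mE nE s_gt0 cu cv; lia.
Qed.

Lemma resolving_dominating_card (S : {set V}) : r = k ->
  resolving adj S -> dist_dominating adj k S -> q + n + (b == 2) <= #|S|.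
Proof.
move=> rk resS /(ladj_dominatingP legbase_le) domS; have qL := q_L.
have b02 : b = 0 \/ b = 2 by case: shape => [[]|[]]; [left | right].
(* Label 0 belongs to center 0 alone. Other path vertices are labelled by block, shifted by [m.+1]
   past all leg numbers. *)
pose f (x : V) := if 0 < leg x then leg x
                  else if pos x == 0 then 0 else m.+1 + (pos x + k) %/ K.
pose miss t := [forall x in S, f x != t].
have missN t x : x \in S -> f x = t -> miss t = false.
  by move=> xS fx; apply/negP=> /labels_missed/(_ x xS).
have missl i : 0 < i -> miss i -> {in S, forall x, leg x <> i}.
  by move=> i0 /labels_missed H x /H; rewrite /f; case: ifP; lia.
have hit_long : count miss (iota 1 p) = 0.
  apply/eqP; rewrite -leqn0 leqNgt -has_count; apply/hasPn=> t.
  rewrite mem_iota => tr; have [x xS] := domS (leaf t).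
  rewrite ldist_sym dist_leaf; last by lia.
  have -> : leglen t = K by rewrite leglenE ifT; lia.
  case: eqP => [lx _|_]; last by lia.
  by rewrite (missN t x) // /f lx ifT; lia.
have hit_center t : 0 < t <= q -> (b = 2 -> t < q) -> ~~ miss (m.+1 + t).
  move=> tr tq; have [x xS] := domS (center t).
  rewrite ldist_sym dist_center; last by lia.
  move=> near; rewrite (missN _ x) // /f -(block_near near).
  have lo : K <= t * K by rewrite leq_pmull; lia.
  have hi : b = 2 -> t * K + K <= L.
    by move=> /tq tq'; rewrite addnC -mulSn LE leq_mul2r tq' orbT.
  by case: (leg_cases x) => cx; rewrite ifF ?ifF; lia.
have near_group : count miss (0 :: iota p.+1 s) <= 1.
  have twin i j : p < i <= n -> p < j <= n -> miss i -> miss j -> i = j.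
    move=> ir jr /missl mi /missl mj; apply: twins resS _ _ _ _; try lia.
    by move=> x xS; split; [apply: mi | apply: mj]; lia.
  (* As [r = k], the only vertex off leg [i] within [k] of its leaf is center 0. *)
  have excl i : p < i <= n -> miss 0 -> ~~ miss i.
    move=> ir m0; apply/negP=> mi; have [x xS] := domS (leaf i).
    rewrite ldist_sym dist_leaf; last by lia.
    have -> : leglen i = k by rewrite leglenE ifF ?ifT ?rk; lia.
    have -> : legbase i = 0 by rewrite legbaseE ifT; lia.
    have li : leg x <> i by apply: missl => //; lia.
    case: eqP => // _ ?; move: (labels_missed m0 xS); rewrite /f.
    by case: (leg_cases x) => cx; do ![case: ifP => ?]; lia.
  apply: count_le1 => [|i j]; first by rewrite /= mem_iota iota_uniq; lia.
  rewrite !inE !mem_iota => /predU1P[->|ir] /predU1P[->|jr] // mi mj.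
  - by have := excl j; rewrite mi mj; lia.
  - by have := excl i; rewrite mi mj; lia.
  - by apply: twin => //; lia.
have sizeS l : uniq l -> size l <= #|S| + count miss l := @size_labels _ f S l.
have hit_centers t : t <= q -> (b = 2 -> t < q) -> count miss (iota m.+2 t) = 0.
  move=> tq tb; apply/eqP; rewrite -leqn0 leqNgt -has_count; apply/hasPn=> i.
  rewrite mem_iota => ir; have -> : i = m.+1 + (i - m.+1) by lia.
  by apply: hit_center; lia.
case: b02 => bE.
  have := sizeS (iota 1 p ++ (0 :: iota p.+1 s) ++ iota m.+2 q).
  rewrite !size_cat !count_cat hit_long hit_centers ?bE // /= !size_iota.
  suff us : uniq (iota 1 p ++ (0 :: iota p.+1 s) ++ iota m.+2 q).
    by move/(_ us); move: near_group => /=; lia.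
  rewrite !cat_uniq /= !iota_uniq /= !mem_iota.
  by rewrite andbT; apply/and4P; split; first [lia |
     apply/hasPn => t; rewrite /= ?inE ?mem_cat ?inE ?mem_iota; lia].
have q0 : 0 < q by case: shape => [[]|[]] //; lia.
have far_group : count miss [:: n.+1; n.+2; m.+1 + q] <= 1.
  have twin : miss n.+1 -> miss n.+2 -> False.
    move=> /missl mi /missl mj; suff : n.+1 = n.+2 by lia.
    apply: twins resS _ _ _ _; try lia.
    by move=> x xS; split; [apply: mi | apply: mj]; lia.
  have excl i : n < i <= m -> miss (m.+1 + q) -> ~~ miss i.
    move=> ir m0; apply/negP=> mi; have [x xS] := domS (leaf i).
    rewrite ldist_sym dist_leaf; last by lia.
    have -> : leglen i = k by rewrite leglenE ifF ?ifF; lia.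
    have -> : legbase i = L by rewrite legbaseE ifF; lia.
    have li : leg x <> i by apply: missl => //; lia.
    case: eqP => // _ ?; apply: (labels_missed m0 xS).
    have xL : pos x = L by have := pos_le legbase_le x; lia.
    have xq : (pos x + k) %/ K = q by apply: block; rewrite mulSn -LE xL; lia.
    rewrite /f xq.
    by case: (leg_cases x) => cx; rewrite ifF ?ifF; lia.
  move: twin (excl n.+1) (excl n.+2) => /=.
  case: (miss n.+1) => tw e1 e2; case: (miss n.+2) in tw e2 *;
    case: (miss (m.+1 + q)) in e1 e2 *; rewrite //=; by [exfalso; auto | lia].
(* There are [p + s.+1 + q.-1 + 3] labels, and at most one is missed in each of the near and far
   groups. *)
pose l := iota 1 p ++ (0 :: iota p.+1 s) ++ iota m.+2 q.-1 ++ [:: n.+1; n.+2; m.+1 + q].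
have := sizeS l; rewrite /l !size_cat !count_cat hit_long hit_centers; try lia.
rewrite [size (_ :: iota _ _)]/= !size_iota.
suff us : uniq l by move/(_ us); rewrite [size _]/= bE; lia.
rewrite /l !cat_uniq /= !iota_uniq /= !mem_iota !inE.
by rewrite ?andbT; repeat (apply/andP; split); first [lia |
     apply/hasPn => t; rewrite /= ?mem_cat ?inE ?mem_cat ?inE ?mem_iota; lia].
Qed.

Lemma family_resolving_domination : r = k ->
  resolving_domination_number adj k = q + n + (b == 2).
Proof.
move=> rk; apply: arg_min_card.
- by rewrite resolving_setT dist_dominating_setT.
(* Since [0 < s], the legs [1..n-1] include all long ones, so the resolving leaves also serve for
   domination. *)
- pose l := [seq center t | t <- iota 0 q.+1] ++ [seq leaf i | i <- iota 1 n.-1] ++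
            nseq (b == 2) (leaf n.+1).
  have cl t : t <= q -> center t \in [set x in l].
    by move=> tq; rewrite inE mem_cat map_f // mem_iota; lia.
  have ll i : 0 < i < n -> leaf i \in [set x in l].
    by move=> ir; rewrite inE !mem_cat (map_f leaf) ?orbT // mem_iota; lia.
  exists [set x in l].
    rewrite centers_dominate // ?centers_resolve //; try exact: cl.
    + by move=> b2; rewrite inE !mem_cat b2 mem_head !orbT.
    + by move=> i ir; apply: ll; lia.
  apply: leq_trans (card_set_seq _) _.
  by rewrite !size_cat !size_map !size_iota size_nseq; lia.
by move=> S /andP[resS domS]; apply: resolving_dominating_card.
Qed.

Lemma short_resolving_domination : q = 0 -> r = 1 -> 1 < s -> 1 < k ->
  resolving_domination_number adj k = n.-1.
Proof.
move=> q0 r1 s1 k1; have b0 : b = 0 by case: shape => [[]|[]]; lia.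
apply: arg_min_card.
- by rewrite resolving_setT dist_dominating_setT.
(* Height [k.+1] is the middle of a long leg and dominates all of it, unlike the leaf. All short
   legs but the last are marked as well. *)
- pose l := [seq vert i 0 k.+1 | i <- iota 1 p] ++ [seq vert i 0 1 | i <- iota p.+1 s.-1].
  have L0 : L = 0 by rewrite LE q0.
  have dl (x : V) i : 0 < i <= p -> ldist x (vert i 0 k.+1) =
      if leg x == i then (height x - k.+1) + (k.+1 - height x) else height x + k.+1.
    move=> ip; have x0 := pos_le legbase_le x; rewrite ldist_vtx; first by lia.
    by right; rewrite legbaseE leglenE !ifT; lia.
  have ds (x : V) i : p < i < n -> ldist x (vert i 0 1) =
      if leg x == i then (height x - 1) + (1 - height x) else height x + 1.
    move=> ip; have x0 := pos_le legbase_le x; rewrite ldist_vtx; first by lia.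
    by right; rewrite legbaseE leglenE ifF ?ifT; lia.
  have ll i : 0 < i <= p -> vert i 0 k.+1 \in l.
    by move=> ir; rewrite mem_cat (map_f (fun i => vert i 0 k.+1)) // mem_iota; lia.
  have ls i : p < i < n -> vert i 0 1 \in l.
    move=> ir; rewrite mem_cat (map_f (fun i => vert i 0 1)) ?orbT // mem_iota; lia.
  exists [set x in l]; last first.
    apply: leq_trans (card_set_seq _) _.
    by rewrite !size_cat !size_map !size_iota; lia.
  apply/andP; split.
    apply/(ladj_resolvingP legbase_le) => u v _ _ E.
    have El i : 0 < i <= p -> ldist u (vert i 0 k.+1) = ldist v (vert i 0 k.+1).
      by move=> ir; apply: E; rewrite inE ll.
    have Es i : p < i < n -> ldist u (vert i 0 1) = ldist v (vert i 0 1).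
      by move=> ir; apply: E; rewrite inE ls.
    have u0 := pos_le legbase_le u; have v0 := pos_le legbase_le v.
    case: (eqVneq u v) => // /eqP uv; exfalso.
    have luv : height u = height v -> leg u <> leg v.
      by move=> hE lE; apply: uv; apply: (coord_inj (base := legbase)) => //; lia.
    (* The middle of a long leg cannot tell symmetric heights apart; the short leaf [p.+1], marked
       because [1 < s], determines the height first. *)
    have hE : height u = height v.
      have := Es p.+1; rewrite !ds; [|lia..].
      case: (leg_cases u) => cu; case: (leg_cases v) => cv; do ![case: eqP => ?]; lia.
    have hit i : 0 < i < n -> leg u <> i /\ leg v <> i.
      move=> ir; have := luv hE; case: (leqP i p) => ip.
        have := El i; rewrite !dl; [|lia..].
        by case: (coordP legbase u) => cu; case: (coordP legbase v) => cv; do ![case: eqP => ?]; lia.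
      have := Es i; rewrite !ds; [|lia..].
      by case: (coordP legbase u) => cu; case: (coordP legbase v) => cv; do ![case: eqP => ?]; lia.
    have := hit (leg u); have := hit (leg v); have := luv hE.
    by case: (leg_cases u) => cu; case: (leg_cases v) => cv; lia.
  apply/(ladj_dominatingP legbase_le) => x.
  have x0 := pos_le legbase_le x.
  have [lx|lx] := boolP (0 < leg x <= p).
    exists (vert (leg x) 0 k.+1); first by rewrite inE ll.
    by rewrite dl // eqxx; case: (leg_cases x); lia.
  (* This leaf is at distance 1 from the center and 2 from the other short leaves, and [2 <= k]. *)
  exists (vert p.+1 0 1); first by rewrite inE ls //; lia.
  rewrite ds; last by lia.
  by case: (leg_cases x) => cx; case: eqP; lia.
by move=> S /andP[/resolving_card]; rewrite q0 addn0.
Qed.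

End Family.

(** * Choice of parameters for each triple *)

Theorem theorem4p2 (k : nat) (hk : 2 <= k) :
  (forall beta gamma alpha : nat,
     0 < beta -> 0 < gamma -> 0 < alpha ->
     maxn gamma beta <= alpha <= gamma + beta ->
     ~ (exists g : nat, 2 <= g /\ (beta, gamma, alpha) = (1, g, g + 1)) ->
     exists (V : finType) (e : rel V),
       [/\ tree e,
           metric_dim e = beta,
           domination_number e k = gamma &
           resolving_domination_number e k = alpha])
  /\
  (forall gamma : nat, 2 <= gamma ->
     ~ (exists (V : finType) (e : rel V),
          [/\ connected_graph e,
              metric_dim e = 1,
              domination_number e k = gamma &
              resolving_domination_number e k = gamma + 1])).
Proof.
split; last first.
  move=> gamma gamma2 [V [e [conn dim1 domE]]].
  by rewrite dim1_resolving_domination ?domE //; lia.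
move=> beta gamma alpha beta0 gamma0 _ /andP[]; rewrite geq_max => /andP[ga ba] agb no.
have long q p s b : 0 < s -> b = 0 /\ (0 < q \/ 1 < p + s) \/ [/\ b = 2, 0 < q & 1 < p + s] ->
    (p + s).-1 + (0 < q) = beta -> 1 + q + p = gamma ->
    q + (p + s) + (b == 2) = alpha ->
  exists (V : finType) (e : rel V),
    [/\ tree e, metric_dim e = beta, domination_number e k = gamma &
        resolving_domination_number e k = alpha].
  move=> s0 shape dimE domE resE; have k0 : 0 < k by lia.
  pose K := k.*2.+1; pose n := p + s.
  exists (lvertex (q * K) (n + b) (leglen k p k K n)).
  exists (@ladj _ _ (legbase n (q * K)) _); split.
  - by apply: ladj_tree; apply: legbase_le.
  - by rewrite -dimE; apply: (@family_dim k q p s k b K n) shape _ _ _ _.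
  - by rewrite -domE; apply: (@family_domination k q p s k b K n) _ _ _ _.
  - by rewrite -resE; apply: (@family_resolving_domination k q p s k b K n) shape _ _ _ _ _.
have [ab|ab] := ltnP alpha (gamma + beta); last first.
  have aE : alpha = gamma + beta by lia.
  have [g1|g1] := leqP gamma 1.
    (* A spider with [beta.+1] legs of length [k]. *)
    by apply: (@long 0 0 beta.+1 0); lia.
  have b1 : 1 < beta.
    rewrite ltnNge; apply/negP=> b1; apply: no; exists gamma; split=> //.
    by congr (_, _, _); lia.
  (* Short legs at both ends force one extra vertex at each end; [1 < beta] comes from the excluded
     triples. *)
  by apply: (@long gamma.-1 0 beta 2); rewrite ?eqxx; try lia; right; split; lia.
have [ltba|leab] := ltnP beta alpha.
  (* The values solve [p + s = beta], [1 + q + p = gamma] and [q + p + s = alpha]; [beta < alpha]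
     makes [q] positive. *)
  by apply: (@long (alpha - beta) (gamma + beta - alpha).-1 (alpha - gamma).+1 0); lia.
have aE : alpha = beta by lia.
(* With [alpha = beta] there is no room for further centers, so [q = 0], [r = 1] and [n = beta.+1];
   [gamma <= beta] gives at least two short legs. *)
pose K := k.*2.+1; pose p := gamma.-1; pose s := (beta - gamma).+2; pose n := p + s.
have shape : 0 = 0 /\ (0 < 0 \/ 1 < n) \/ [/\ 0 = 2, 0 < 0 & 1 < n].
  by left; split=> //; right; rewrite /n /p /s; lia.
exists (lvertex (0 * K) (n + 0) (leglen k p 1 K n)).
exists (@ladj _ _ (legbase n (0 * K)) _); split.
- by apply: ladj_tree; apply: legbase_le.
- rewrite (@family_dim k 0 p s 1 0 K n) //; first by rewrite /n /p /s; lia.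
  by lia.
- rewrite (@family_domination k 0 p s 1 0 K n) //; first by rewrite /p; lia.
  by lia.
rewrite (@short_resolving_domination k 0 p s 1 0 K n) //; first by rewrite /n /p /s; lia.
by lia.
Qed.
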